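(* Let $d,g\in\mathcal{F}_0$ and $f\in\mathcal{F}_1$, and let $d_0=d(0)$. Then the almost-Riordan array $(d\,|\,g,f)$ can be written as the matrix product $$(d\,|\,g,f)=[d,tg]\,(1\,|\,1,f),$$ or equivalently, in block form, $$(d\,|\,g,f)=\begin{bmatrix} d_0&0\\ \frac{d-d_0}{t}&(g,t)\end{bmatrix}\begin{bmatrix}1&0\\0&(1,f)\end{bmatrix}.$$
   Context: For $k\ge 0$, $\mathcal{F}_k$ denotes the set of formal power series $\sum_{n\ge k}a_nt^n$ with real coefficients and $a_k\neq 0$. All matrices are infinite, with rows and columns indexed by $0,1,2,\dots$; writing a matrix as a list $(u_0,u_1,u_2,\dots)$ of formal power series means that the $(n,k)$ entry is the coefficient of $t^n$ in $u_k$; a power series appearing as a block of a matrix stands for the column of its coefficients. The Riordan array is $(g,f)=(g,gf,gf^2,\dots)$. The almost-Riordan array is $(d\,|\,g,f)=(d,tg,tgf,tgf^2,\dots)$. For $d\in\mathcal{F}_0$ and $h\in\mathcal{F}_1$ the quasi-Riordan array is $[d,h]=(d,h,th,t^2h,\dots)$. The paper calls the displayed factorization a semidirect product. *)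

(* Defs.v *)
From mathcomp Require Import all_boot all_order all_algebra reals.

Set Implicit Arguments.
Unset Strict Implicit.
Unset Printing Implicit Defensive.

Import GRing.Theory.
Local Open Scope ring_scope.

(* A formal power series is its coefficient sequence. *)
Definition fps (R : Type) := nat -> R.

Section FormalPowerSeries.
Variable R : nzRingType.
Implicit Types (a b : fps R) (c : R).

Definition fps_const c : fps R := fun n => if n == 0%N then c else 0.

Definition fps_t : fps R := fun n => if n == 1%N then 1 else 0.

Definition fps_sub a b : fps R := fun n => a n - b n.

Definition fps_mul a b : fps R := fun n => \sum_(i < n.+1) a i * b (n - i)%N.

Definition fps_exp a (k : nat) : fps R := iter k (fps_mul a) (fps_const 1).

(* The quotient a / t; it is the inverse of multiplication by t only when
   a 0 = 0. *)
Definition fps_divt a : fps R := fun n => a n.+1.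

(* Membership in F_k: a has order exactly k. *)
Definition fps_F (k : nat) a : Prop :=
  (forall i : nat, (i < k)%N -> a i = 0) /\ a k <> 0.

End FormalPowerSeries.

Arguments fps_t {R}.

Definition imx (R : Type) := nat -> nat -> R.

Section InfiniteMatrices.
Variable R : nzRingType.
Implicit Types (A B C M : imx R) (d g f h : fps R).

Definition imx_cols (u : nat -> fps R) : imx R := fun n k => u k n.

(* C is the product A B: every sum \sum_j A n j * B j k has only finitely many
   nonzero terms, and its value is C n k.  Such a C is unique up to =2. *)
Definition is_imx_mul A B C : Prop :=
  forall n k : nat, exists N : nat,
    (forall j : nat, (N <= j)%N -> A n j * B j k = 0) /\
    C n k = \sum_(j < N) A n j * B j k.

(* The block matrix [[c, r], [u, M]] with a 1 x 1 upper left block. *)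
Definition imx_block (c : R) (r : nat -> R) (u : fps R) M : imx R :=
  fun n k =>
    match n, k with
    | 0%N, 0%N => c
    | 0%N, k'.+1 => r k'
    | n'.+1, 0%N => u n'
    | n'.+1, k'.+1 => M n' k'
    end.

(* (g, f) *)
Definition riordan g f : imx R :=
  imx_cols (fun k => fps_mul g (fps_exp f k)).

(* (d | g, f) *)
Definition almost_riordan d g f : imx R :=
  imx_cols (fun k =>
    if k is k'.+1 then fps_mul (fps_mul fps_t g) (fps_exp f k') else d).

(* [d, h] *)
Definition quasi_riordan d h : imx R :=
  imx_cols (fun k => if k is k'.+1 then fps_mul (fps_exp fps_t k') h else d).

End InfiniteMatrices.

(* Main.v *)
(* An almost-Riordan array is block lower triangular, with first column d and
   lower right block (g, f); both factors have the same shape, so everything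
   reduces to the identity (g, t) (1, f) = (g, f), whose entries are the Cauchy
   products defining g f^k because (g, t) is the Toeplitz matrix g_(n-k). *)
Require Import Defs.
From mathcomp Require Import all_boot all_order all_algebra reals.

Set Implicit Arguments.
Unset Strict Implicit.
Unset Printing Implicit Defensive.

Import GRing.Theory.
Local Open Scope ring_scope.

Section FormalPowerSeries.
Variable R : nzRingType.
Implicit Types (a b : fps R).

Lemma fps_mul_t0 a : fps_mul fps_t a 0%N = 0.
Proof. by rewrite /fps_mul big_ord1 mul0r. Qed.

Lemma fps_mul_tS a n : fps_mul fps_t a n.+1 = a n.
Proof.
rewrite /fps_mul !big_ord_recl big1 => [|i _]; last by rewrite mul0r.
by rewrite /= mul0r mul1r add0r addr0 subn1.
Qed.

Lemma fps_mul1 b n : fps_mul (fps_const 1) b n = b n.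
Proof.
rewrite /fps_mul big_ord_recl big1 => [|i _]; last by rewrite mul0r.
by rewrite /= mul1r addr0 subn0.
Qed.

Lemma fps_mul_tl0 a b : fps_mul (fps_mul fps_t a) b 0%N = 0.
Proof. by rewrite /fps_mul !big_ord1 !mul0r. Qed.

Lemma fps_mul_tlS a b n : fps_mul (fps_mul fps_t a) b n.+1 = fps_mul a b n.
Proof.
rewrite {1}/fps_mul big_ord_recl fps_mul_t0 mul0r add0r.
by apply: eq_bigr => i _; rewrite fps_mul_tS.
Qed.

Lemma fps_exp_t k n : fps_exp fps_t k n = (n == k)%:R :> R.
Proof.
elim: k n => [|k IHk] [|n] //; first exact: fps_mul_t0.
by rewrite /fps_exp iterS fps_mul_tS [LHS]IHk eqSS.
Qed.

Lemma fps_mul_exp_tl k a n :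
  fps_mul (fps_exp fps_t k) a n = if (k <= n)%N then a (n - k)%N else 0.
Proof.
rewrite /fps_mul; under eq_bigr do rewrite fps_exp_t mulr_natl mulrb.
rewrite -big_mkcond /=; have [le_kn|lt_nk] := leqP k n.
  by rewrite (big_pred1 (Ordinal (le_kn : (k < n.+1)%N))).
by apply: big_pred0 => i; rewrite ltn_eqF // (leq_trans (ltn_ord i)).
Qed.

(** Powers of t are central even over a noncommutative [R]: reversing the sum swaps the two factors,
    and the coefficients of t^k are 0 or 1. *)
Lemma fps_mul_exp_tr k a n :
  fps_mul a (fps_exp fps_t k) n = if (k <= n)%N then a (n - k)%N else 0.
Proof.
rewrite -fps_mul_exp_tl /fps_mul (reindex_inj rev_ord_inj) /=.
apply: eq_bigr => i _; rewrite subSS subKn -1?ltnS //.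
by rewrite !fps_exp_t mulr_natl mulr_natr.
Qed.

End FormalPowerSeries.

Section InfiniteMatrices.
Variable R : nzRingType.
Implicit Types (A B C : imx R) (d g f u : fps R).

(** Transport along [=2], since the block forms agree with the arrays only entrywise. *)
Lemma eq_is_imx_mul A A' B B' C C' :
  A =2 A' -> B =2 B' -> C =2 C' -> is_imx_mul A B C -> is_imx_mul A' B' C'.
Proof.
move=> eqA eqB eqC mulAB n k; have [N [AB0 CE]] := mulAB n k; exists N; split.
  by move=> j le_Nj; rewrite -eqA -eqB AB0.
by rewrite -eqC CE; apply: eq_bigr => j _; rewrite eqA eqB.
Qed.

Lemma is_imx_mul_block c u A B C :
  is_imx_mul A B C ->
  is_imx_mul (imx_block c (fun _ => 0) u A)
             (imx_block 1 (fun _ => 0) (fun _ => 0) B)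
             (imx_block c (fun _ => 0) u C).
Proof.
move=> mulAB n [|k].
  exists 1%N; split=> [[|j] // _|]; first by rewrite mulr0.
  by rewrite big_ord1 mulr1.
case: n => [|n].
  exists 1%N; split=> [[|j] // _|]; first by rewrite mul0r.
  by rewrite big_ord1 mulr0.
(* Inner index j is outer index j + 1, so the bound grows by one; the extra head term meets the zero
   upper right block of the right factor. *)
have [N [AB0 CE]] := mulAB n k; exists N.+1; split=> [[|j] //|].
  exact: AB0.
by rewrite big_ord_recl mulr0 add0r.
Qed.

Lemma riordan_factor g f :
  is_imx_mul (riordan g fps_t) (riordan (fps_const 1) f) (riordan g f).
Proof.
(* Row n of the lower triangular array (g, t) vanishes beyond column n. *)
move=> n k; rewrite /riordan /imx_cols; exists n.+1; split=> [j lt_nj|].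
  by rewrite fps_mul_exp_tr leqNgt lt_nj mul0r.
(* Reversal matches the Cauchy terms g_i (f^k)_(n-i) with the matrix terms g_(n-j) (f^k)_j. *)
rewrite {1}/fps_mul (reindex_inj rev_ord_inj) /=.
apply: eq_bigr => i _; have le_in : (i <= n)%N by rewrite -ltnS.
by rewrite fps_mul1 fps_mul_exp_tr le_in subSS subKn.
Qed.

(** Each column after the first carries a factor t: its row 0 is zero, and deleting that row divides
    by t. *)
Lemma almost_riordan_block d g f :
  almost_riordan d g f =2
  imx_block (d 0%N) (fun _ => 0) (fps_divt (fps_sub d (fps_const (d 0%N))))
            (riordan g f).
Proof.
move=> [|n] [|k] //=; first exact: fps_mul_tl0.
  by rewrite /fps_divt /fps_sub subr0.
exact: fps_mul_tlS.
Qed.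

(** Since t^k (t g) = (t g) t^k, the array [d, tg] is (d | g, t), which has the block form already
    found. *)
Lemma quasi_riordan_block d g :
  quasi_riordan d (fps_mul fps_t g) =2
  imx_block (d 0%N) (fun _ => 0) (fps_divt (fps_sub d (fps_const (d 0%N))))
            (riordan g fps_t).
Proof.
move=> n k; rewrite -almost_riordan_block.
case: k => [//|k]; rewrite /quasi_riordan /almost_riordan /imx_cols.
rewrite fps_mul_exp_tl; case: n => [|n].
  by rewrite fps_mul_tl0 fps_mul_t0 if_same.
(* The two sides have cutoffs k <= n + 1 and k <= n; at k = n + 1 the left side is (t g)_0 = 0. *)
rewrite fps_mul_tlS fps_mul_exp_tr; case: (ltngtP k n.+1) => [lt_kn|lt_nk|->].
- by rewrite -ltnS lt_kn subSn // fps_mul_tS.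
- by rewrite leqNgt (ltnW lt_nk).
- by rewrite subnn ltnn fps_mul_t0.
Qed.

End InfiniteMatrices.

Theorem proposition2p6 (R : realType) (d g f : fps R)
    (hd : fps_F 0 d) (hg : fps_F 0 g) (hf : fps_F 1 f) :
  let d0 := d 0%N in
  let Q := quasi_riordan d (fps_mul fps_t g) in
  let A := almost_riordan (fps_const 1) (fps_const 1) f in
  let Qblock := imx_block d0 (fun _ => 0)
                  (fps_divt (fps_sub d (fps_const d0))) (riordan g fps_t) in
  let Ablock := imx_block 1 (fun _ => 0) (fun _ => 0)
                  (riordan (fps_const 1) f) in
  is_imx_mul Q A (almost_riordan d g f) /\
  (Q =2 Qblock /\ A =2 Ablock /\
   is_imx_mul Qblock Ablock (almost_riordan d g f)).
Proof.
move=> d0 Q A Qblock Ablock.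
have QE : Q =2 Qblock by exact: quasi_riordan_block.
have AE : A =2 Ablock.
  (* Here d = 1, so the lower left column (d - d_0)/t is zero. *)
  move=> n k; rewrite /A almost_riordan_block.
  by case: n k => [|n] [|k] //=; rewrite /fps_divt /fps_sub subr0.
have mulblock : is_imx_mul Qblock Ablock (almost_riordan d g f).
  apply: eq_is_imx_mul (is_imx_mul_block _ _ (riordan_factor g f)) => // n k.
  by rewrite almost_riordan_block.
by split=> //; apply: eq_is_imx_mul mulblock.
Qed.
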